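(* $pal=swap(pil)$, i.e. for all $r\ge0$, $pal(u_1,\dots,u_r)=pil(u_1+\dots+u_r,\ u_1+\dots+u_{r-1},\ \dots,\ u_1+u_2,\ u_1)$.
   Context: Moulds are families of functions $A(u_1,\dots,u_r)$ and $v$-moulds $A(v_1,\dots,v_r)$, $r\ge0$; $mu(A,B)(w_1..w_r)=\sum_{i=0}^rA(w_1..w_i)B(w_{i+1}..w_r)$. For a $v$-mould $M$, $swap(M)$ is the mould $swap(M)(u_1,\dots,u_r)=M(u_1+\dots+u_r,u_1+\dots+u_{r-1},\dots,u_1)$. Operators: $(der\,A)(w_1..w_r)=r\,A(w_1..w_r)$, $(dur\,A)(u_1..u_r)=(u_1+\dots+u_r)A(u_1..u_r)$. $v$-mould operations: for $\mathbf w=(v_1..v_r)=\mathbf a\mathbf b\mathbf c$, $\mathbf a=(v_1..v_k)$, $\mathbf b=(v_{k+1}..v_{k+l})$, $\mathbf c=(v_{k+l+1}..v_r)$: $\mathbf b\rfloor=(v_{k+1}-v_{k+l+1},\dots,v_{k+l}-v_{k+l+1})$, $\lfloor\mathbf b=(v_{k+1}-v_k,\dots,v_{k+l}-v_k)$, $(arit(B)A)(\mathbf w)=\sum_{\mathbf b,\mathbf c\ne\emptyset}A(\mathbf a\mathbf c)B(\mathbf b\rfloor)-\sum_{\mathbf a,\mathbf b\ne\emptyset}A(\mathbf a\mathbf c)B(\lfloor\mathbf b)$, $preari(A,B)=arit(B)A+mu(A,B)$. $dipil$ is the $v$-mould with $dipil(\emptyset)=0$ and $dipil(v_1,\dots,v_r)=\frac{-1}{(r+1)!}\frac{v_1+\dots+v_r}{v_1(v_1-v_2)\cdots(v_{r-1}-v_r)v_r}$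 for $r\ge1$; $pil$ is the $v$-mould with $pil(\emptyset)=1$ determined recursively in depth by $der\,pil=preari(pil,dipil)$ (this is the mould attached to the diffeomorphism $1-e^{-x}$). $dupal$ is the mould with $dupal(\emptyset)=0$ and $dupal(u_1,\dots,u_r)=\frac{B_r}{r!}\frac{1}{u_1\cdots u_r}\sum_{i=0}^{r-1}(-1)^i\binom{r-1}{i}u_{i+1}$ ($B_r$ the Bernoulli numbers, $B_1=-1/2$); $pal$ is the mould with $pal(\emptyset)=1$ determined recursively in depth by $dur\,pal=mu(pal,dupal)$. *)

(* Defs.v *)
From mathcomp Require Import all_boot all_order all_algebra.

Set Implicit Arguments.
Unset Strict Implicit.
Unset Printing Implicit Defensive.

Import GRing.Theory.
Local Open Scope ring_scope.

(* The depth-r component of a mould A is the restriction of A to words of      *)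
(* length r. Moulds in the u_i and v-moulds in the v_i share this type.         *)
Definition mould (K : fieldType) : Type := seq K -> K.

Section Operations.
Variable K : fieldType.
Implicit Types (A B M : mould K) (a b c w u v : seq K).

Definition mu A B : mould K :=
  fun w => \sum_(i < (size w).+1) A (take i w) * B (drop i w).

Definition swap M : mould K :=
  fun u => M (mkseq (fun i => \sum_(x <- take (size u - i) u) x) (size u)).

Definition der A : mould K := fun w => A w *+ size w.

Definition dur A : mould K := fun u => (\sum_(x <- u) x) * A u.

(* rflex b c is b with the first letter of c subtracted from each letter, and  *)
(* lflex a b is b with the last letter of a subtracted from each letter; they  *)
(* are only used with c, resp. a, nonempty.                                    *)
Definition rflex b c : seq K := [seq x - head 0 c | x <- b].
Definition lflex a b : seq K := [seq x - last 0 a | x <- b].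

(* k and l are the lengths of a and b in w = abc. *)
Definition arit B A : mould K := fun w =>
  let r := size w in
  let a k := take k w in
  let b k l := take l (drop k w) in
  let c k l := drop (k + l) w in
  \sum_(k < r.+1) \sum_(l < r.+1 | (0 < l)%N && (k + l < r)%N)
     A (a k ++ c k l) * B (rflex (b k l) (c k l))
  - \sum_(k < r.+1) \sum_(l < r.+1 | [&& 0 < k, 0 < l & k + l <= r]%N)
     A (a k ++ c k l) * B (lflex (a k) (b k l)).

Definition preari A B : mould K := fun w => arit B A w + mu A B w.

(* The denominator is v_1 (v_1 - v_2) ... (v_(r-1) - v_r) v_r, so it is v_1^2  *)
(* in depth 1.                                                                 *)
Definition dipil : mould K := fun v =>
  if v is [::] then 0 else
  let r := size v in
  (- 1 / (r.+1)`!%:R) *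
  ((\sum_(x <- v) x) /
   (v`_0 * (\prod_(i < r.-1) (v`_i - v`_i.+1)) * v`_r.-1)).

(* Solution of der pil = preari pil dipil with value 1 on the empty word; n    *)
(* bounds the depth of the recursion. See der_pil.                             *)
Fixpoint pil_rec (n : nat) (v : seq K) : K :=
  if v is [::] then 1 else
  if n is m.+1 then (size v)%:R^-1 * preari (pil_rec m) dipil v else 0.

Definition pil : mould K := fun v => pil_rec (size v) v.

(* [:: B_0; ...; B_n], from \sum_(k <= m) 'C(m+1, k) B_k = 0 for m > 0; this   *)
(* is the convention B_1 = -1/2.                                               *)
Fixpoint bernoulli_seq (n : nat) : seq K :=
  if n is m.+1 then
    let s := bernoulli_seq m in
    rcons s (- (\sum_(k < n) 'C(n.+1, k)%:R * s`_k) / n.+1%:R)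
  else [:: 1].

Definition bernoulli (n : nat) : K := (bernoulli_seq n)`_n.

Definition dupal : mould K := fun u =>
  if u is [::] then 0 else
  let r := size u in
  bernoulli r / r`!%:R * (\prod_(x <- u) x)^-1 *
  \sum_(i < r) (-1) ^+ i * 'C(r.-1, i)%:R * u`_i.

(* Solution of dur pal = mu pal dupal with value 1 on the empty word; n bounds *)
(* the depth of the recursion. See dur_pal.                                    *)
Fixpoint pal_rec (n : nat) (u : seq K) : K :=
  if u is [::] then 1 else
  if n is m.+1 then (\sum_(x <- u) x)^-1 * mu (pal_rec m) dupal u else 0.

Definition pal : mould K := fun u => pal_rec (size u) u.

(* The moulds pal and pil are rational functions in each depth. Since 0^-1 = 0 *)
(* here, they are compared where no denominator of their recursions vanishes:  *)
(* u_(i+1) + ... + u_j is nonzero for all i < j, which for the v-word          *)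
(* (u_1 + ... + u_r, ..., u_1) says that its letters are nonzero and distinct. *)
Definition off_poles (u : seq K) : Prop :=
  forall i j : nat, (i < j <= size u)%N -> \sum_(x <- drop i (take j u)) x != 0.

Lemma eq_mu A A' B w : B [::] = 0 ->
  (forall x, (size x < size w)%N -> A x = A' x) -> mu A B w = mu A' B w.
Proof.
move=> B0 AA'; apply: eq_bigr => i _.
have [lt_i|le_i] := ltnP i (size w); last by rewrite drop_oversize // B0 !mulr0.
by rewrite AA' // size_take lt_i.
Qed.

Lemma eq_arit A A' B w :
  (forall x, (size x < size w)%N -> A x = A' x) -> arit B A w = arit B A' w.
Proof.
move=> AA'.
have lt_ac (k l : nat) : (0 < l)%N -> (k + l <= size w)%N ->
    (size (take k w ++ drop (k + l) w) < size w)%N.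
  move=> l0 kl; rewrite size_cat size_drop size_takel; last first.
    by rewrite (leq_trans (leq_addr l k)).
  by rewrite -{2}(subnKC kl) -addnA ltn_add2l -[ltnLHS]add0n ltn_add2r.
rewrite /arit /=; congr (_ - _); apply: eq_bigr => k _; apply: eq_bigr => l.
  by case/andP=> l0 kl; rewrite AA' // lt_ac // ltnW.
by case/and3P=> _ l0 kl; rewrite AA' // lt_ac.
Qed.

Lemma pil_recE n v : (size v <= n)%N -> pil_rec n v = pil v.
Proof.
suff H m : (size v <= n)%N -> (size v <= m)%N -> pil_rec n v = pil_rec m v.
  by move=> len; apply: H.
elim: n m v => [|n IH] [|m] [|x v] //= len lem; congr (_ * _).
have e y : (size y < size (x :: v))%N -> pil_rec n y = pil_rec m y.
  by rewrite ltnS => ley; apply: IH; apply: leq_trans ley _.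
by rewrite /preari (eq_arit _ e) (eq_mu _ e).
Qed.

Lemma pal_recE n u : (size u <= n)%N -> pal_rec n u = pal u.
Proof.
suff H m : (size u <= n)%N -> (size u <= m)%N -> pal_rec n u = pal_rec m u.
  by move=> len; apply: H.
elim: n m u => [|n IH] [|m] [|x u] //= len lem; congr (_ * _).
apply: eq_mu => // y; rewrite ltnS => ley.
by apply: IH; apply: leq_trans ley _.
Qed.

Lemma pil_nil : pil [::] = 1. Proof. by []. Qed.

Lemma der_pil v : [pchar K] =i pred0 -> der pil v = preari pil dipil v.
Proof.
move=> /pcharf0P charK; case: v => [|x v].
  rewrite /der /preari /arit /mu /= !big_ord1 mulr0 mulr0n addr0.
  by rewrite !big_pred0 ?subr0 // => l; rewrite andbF.
have e y : (size y < size (x :: v))%N -> pil_rec (size v) y = pil y.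
  by move=> ley; rewrite pil_recE.
rewrite /der {1}/pil [pil_rec _ _]/= -[LHS]mulr_natl mulrA divff ?mul1r ?charK //.
by rewrite /preari (eq_arit _ e) (eq_mu _ e).
Qed.

Lemma pal_nil : pal [::] = 1. Proof. by []. Qed.

Lemma dur_pal u : off_poles u -> dur pal u = mu pal dupal u.
Proof.
case: u => [|x u] gu; first by rewrite /dur /mu big_nil big_ord1 mul0r mulr0.
have e y : (size y < size (x :: u))%N -> pal_rec (size u) y = pal y.
  by move=> ley; rewrite pal_recE.
have u0 : \sum_(y <- x :: u) y != 0.
  by have := gu 0 (size (x :: u)); rewrite drop0 take_size; apply=> /=.
by rewrite /dur {1}/pal [pal_rec _ _]/= mulrA divff // mul1r (eq_mu _ e).
Qed.

Lemma size_bernoulli_seq n : size (bernoulli_seq n) = n.+1.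
Proof. by elim: n => //= n IH; rewrite size_rcons IH. Qed.

Lemma nth_bernoulli_seq n k : (k <= n)%N -> (bernoulli_seq n)`_k = bernoulli k.
Proof.
elim: n => [|n IH]; first by rewrite leqn0 => /eqP->.
rewrite leq_eqVlt => /predU1P[-> //|lekn].
by rewrite [bernoulli_seq _]/= nth_rcons size_bernoulli_seq lekn IH.
Qed.

Lemma sum_bernoulli n : [pchar K] =i pred0 ->
  \sum_(k < n.+1) 'C(n.+1, k)%:R * bernoulli k = (n == 0)%:R.
Proof.
move=> /pcharf0P charK.
case: n => [|n]; first by rewrite big_ord1 bin0 mul1r.
rewrite big_ord_recr /= {2}/bernoulli [bernoulli_seq _]/= nth_rcons.
rewrite size_bernoulli_seq ltnn eqxx binSn mulrCA divff ?charK // mulr1.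
apply/eqP; rewrite subr_eq0; apply/eqP; apply: eq_bigr => k _.
by rewrite nth_bernoulli_seq // -ltnS.
Qed.

End Operations.

Arguments dipil {K}.
Arguments pil {K}.
Arguments dupal {K}.
Arguments pal {K}.

(* Main.v *)
(* Write T and I for the depth-one moulds 1/u and 1. Under swap, concatenation *)
(* of u-moulds becomes the product [star] of v-moulds, and                      *)
(* Theta A = preari(A, B) - star A B is a derivation of it for every B with     *)
(* B(0) = 0; hence so is Delta = der - Theta. For B = dipil a computation in    *)
(* depth one gives Delta T = exp(T) - 1 and Delta I = exp(T) I. Now dupal is    *)
(* the series of B_r / r! times (r-1)-fold commutators of T with I, and Delta   *)
(* of it is computed in polynomials, where T acting on the left and on the      *)
(* right of I become two variables, one of them set to 1. By the difference     *)
(* equation of the Bernoulli polynomials the result is                          *)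
(* Delta dupal = v_1 dipil. It follows that the mould                           *)
(* X = v_1 pil - star dupal pil satisfies der X = preari(X, dipil), so X = 0,   *)
(* which is the recursion defining pal.                                         *)

(* At a word of partial sums, [v_1] becomes [u_1 + ... + u_r] and [star] becomes [mu] with its
   factors exchanged ([star_psums]). So the recursion of [pal] amounts to [lam pil = star dupil pil]
   ([lam_pil]), where [dupil] is the v-mould whose swap is [dupal] ([dupil_psums]). Both sides solve
   der X = preari(X, dipil) + star (lam dipil) pil: the left one by [preari_lam], the right one by
   [preari_star] and [delta_dupil]. As [dipil] vanishes on the empty word, this equation determines
   X depth by depth in characteristic 0. The heart is [delta_dupil]. Since exp(T) commutes with T,
   Delta(ad_T^i I) = i [exp(T) - 1, ad_T^(i-1) I] + ad_T^i (exp(T) I) ([delta_adI]). Summing with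
   weights B_(i+1)/(i+1)! leaves an identity between polynomials in one variable
   ([bernoulli_poly_sum]), a consequence of B_n(x+1) - B_n(x) = n x^(n-1). *)
Require Import Defs.
From mathcomp Require Import all_boot all_order all_algebra.
From mathcomp Require Import ring zify.

Set Implicit Arguments.
Unset Strict Implicit.
Unset Printing Implicit Defensive.

Import GRing.Theory.
Local Open Scope ring_scope.


(** * Sums over the cuts of a word *)

Section Cuts.
Variable K : fieldType.
Implicit Types (f g : seq K -> seq K -> K) (a b c w : seq K).

(** Recursion on the word, instead of an index sum as in [mu], lets identities between iterated cuts
    go by plain induction. *)
Fixpoint csum f w : K :=
  f [::] w + (if w is x :: w' then csum (fun a b => f (x :: a) b) w' else 0).

Lemma eq_csum f g w : (forall a b, a ++ b = w -> f a b = g a b) ->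
  csum f w = csum g w.
Proof.
elim: w f g => [|x w IH] f g fg /=; rewrite fg //; congr (_ + _).
by apply: IH => a b ab; apply: fg; rewrite /= ab.
Qed.

Lemma csumE f w :
  csum f w = \sum_(i < (size w).+1) f (take i w) (drop i w).
Proof.
elim: w f => [|x w IH] f; first by rewrite big_ord1 /= addr0.
by rewrite big_ord_recl /= IH.
Qed.

Lemma csum0 w : csum (fun _ _ => 0) w = 0.
Proof. by rewrite csumE big1. Qed.

Lemma csumD f g w : csum (fun a b => f a b + g a b) w = csum f w + csum g w.
Proof. by rewrite !csumE big_split. Qed.

Lemma csumB f g w : csum (fun a b => f a b - g a b) w = csum f w - csum g w.
Proof. by rewrite !csumE sumrB. Qed.

Lemma csumZl k f w : csum (fun a b => k * f a b) w = k * csum f w.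
Proof. by rewrite !csumE mulr_sumr. Qed.

Lemma csumZr k f w : csum (fun a b => f a b * k) w = csum f w * k.
Proof. by rewrite !csumE mulr_suml. Qed.

Lemma csum_map (h : K -> K) f w :
  csum f (map h w) = csum (fun a b => f (map h a) (map h b)) w.
Proof. by elim: w f => [|x w IH] f //=; rewrite IH. Qed.

Lemma csumA (f : seq K -> seq K -> seq K -> K) w :
  csum (fun a v => csum (f a) v) w =
  csum (fun v c => csum (fun a b => f a b c) v) w.
Proof.
elim: w f => [|x w IH] f //=.
by rewrite IH csumD addr0 !addrA.
Qed.

(* The cut at the junction is counted on both sides. *)
Lemma csum_cat f w v : csum f (w ++ v) =
  csum (fun a b => f a (b ++ v)) w + csum (fun a b => f (w ++ a) b) v - f w v.
Proof.
elim: w f => [|x w IH] f /=; first by rewrite addr0 addrAC subrr add0r.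
by rewrite IH !addrA.
Qed.

Lemma csum_rev f w : csum f (rev w) = csum (fun a b => f (rev b) (rev a)) w.
Proof.
rewrite !csumE size_rev (reindex_inj rev_ord_inj) /=.
apply: eq_bigr => i _; rewrite subSS take_rev drop_rev subKn //.
by rewrite -ltnS.
Qed.

Lemma csum_exchange (f : seq K -> seq K -> seq K -> seq K -> K) u v :
  csum (fun a b => csum (f a b) v) u =
  csum (fun c d => csum (fun a b => f a b c d) u) v.
Proof.
rewrite csumE; under eq_bigr do rewrite csumE.
by rewrite exchange_big csumE; apply: eq_bigr => i _; rewrite csumE.
Qed.

Lemma csum_nil (f : seq K -> seq K -> K) w :
  (forall a b, a ++ b = w -> a != [::] -> f a b = 0) -> csum f w = f [::] w.
Proof.
case: w => [|x w] /= f0; first by rewrite addr0.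
rewrite (eq_csum (g := fun _ _ => 0)) ?csum0 ?addr0 // => a b ab.
by rewrite f0 //= ab.
Qed.

Lemma csum_last (f : seq K -> seq K -> K) w :
  (forall a b, a ++ b = w -> b != [::] -> f a b = 0) -> csum f w = f w [::].
Proof.
move=> f0; rewrite csumE big_ord_recr /= take_size drop_size big1 ?add0r // => i _.
rewrite f0 ?cat_take_drop //.
by rewrite -size_eq0 size_drop subn_eq0 -ltnNge.
Qed.

Lemma csum_rcons (f : seq K -> seq K -> K) w y : csum f (rcons w y) =
  csum (fun a b => f a (rcons b y)) w + f (rcons w y) [::].
Proof.
elim: w f => [|x w IH] f /=; first by rewrite !addr0.
by rewrite IH addrA.
Qed.

End Cuts.

(** * The flexions as derivations *)

Section Flexions.
Variable K : fieldType.
Implicit Types (A B D M : mould K) (a b c w u v : seq K).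

Definition star A B : mould K := csum (fun b c => A (rflex b c) * B c).

(** The counterpart of [dur]: the first letter of the swapped word is [u_1 + ... + u_r]. *)
Definition lam A : mould K := fun w => head 0 w * A w.

Definition rins B A : mould K :=
  csum (fun a => csum (fun b c => A (a ++ c) * B (rflex b c))).

Definition lins B A : mould K :=
  csum (fun a => csum (fun b c => (a != [::])%:R * (A (a ++ c) * B (lflex a b)))).

Definition theta B A : mould K := fun w => preari A B w - star A B w.

Lemma muE A B w : mu A B w = csum (fun a b => A a * B b) w.
Proof. by rewrite csumE. Qed.

Lemma rflex0 b : rflex b [::] = b.
Proof. by rewrite /rflex /= -[RHS]map_id; apply: eq_map => x; rewrite subr0. Qed.

(** The index ranges of [arit] omit only vanishing terms, so they extend to all factorisations of
    [w] in three. *)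
Lemma csum_arit (f : seq K -> seq K -> seq K -> K) (P : nat -> nat -> bool) w :
  (forall k l, P k l -> (k + l <= size w)%N) ->
  (forall a b c, a ++ b ++ c = w -> ~~ P (size a) (size b) -> f a b c = 0) ->
  \sum_(k < (size w).+1) \sum_(l < (size w).+1 | P k l)
    f (take k w) (take l (drop k w)) (drop (k + l) w)
  = csum (fun a => csum (f a)) w.
Proof.
move=> Ple f0; rewrite csumE; apply: eq_bigr => -[k lek] _ /=.
rewrite csumE size_drop.
rewrite (big_ord_widen (size w).+1 (fun l =>
  f (take k w) (take l (drop k w)) (drop l (drop k w)))); last by lia.
rewrite big_mkcond [RHS]big_mkcond; apply: eq_bigr => -[l lel] _ /=.
rewrite drop_drop [(l + k)%N]addnC; case: ifP => Pkl; case: ifP => //.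
  by have := Ple _ _ Pkl; lia.
move=> H; rewrite f0 ?[(k + l)%N]addnC -?drop_drop ?cat_take_drop //.
by rewrite !size_takel ?Pkl ?size_drop; lia.
Qed.

(* The term mu A B of preari is the missing case c = 0 of the first sum of arit. *)
Lemma preariE A B w : B [::] = 0 -> preari A B w = rins B A w - lins B A w.
Proof.
move=> B0; rewrite /preari /arit /=.
pose f a b c := A (a ++ c) * B (rflex b c).
pose g a b c := (a != [::])%:R * (A (a ++ c) * B (lflex a b)).
have -> : \sum_(k < (size w).+1)
    \sum_(l < (size w).+1 | [&& 0 < k, 0 < l & k + l <= size w]%N)
     A (take k w ++ drop (k + l) w) * B (lflex (take k w) (take l (drop k w)))
   = csum (fun a => csum (g a)) w.
  rewrite -(@csum_arit g (fun k l => [&& 0 < k, 0 < l & k + l <= size w]%N)).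
  - apply: eq_bigr => -[k lek] _; apply: eq_bigr => -[l lel] /= /and3P[k0 _ _].
    by rewrite /g -size_eq0 size_takel // -lt0n k0 mul1r.
  - by move=> k l /and3P[].
  move=> a b c <-; rewrite /g !size_cat addnA leq_addr andbT !lt0n !size_eq0.
  by case: a b => [|x a] [|y b] //=; rewrite ?mul0r // B0 !mulr0.
pose f' a b c := (c != [::])%:R * (A (a ++ c) * B (rflex b c)).
have -> : \sum_(k < (size w).+1) \sum_(l < (size w).+1 | (0 < l)%N && (k + l < size w)%N)
     A (take k w ++ drop (k + l) w) * B (rflex (take l (drop k w)) (drop (k + l) w))
   = csum (fun a => csum (f' a)) w.
  rewrite -(@csum_arit f' (fun k l => (0 < l)%N && (k + l < size w)%N)).
  - apply: eq_bigr => -[k lek] _; apply: eq_bigr => -[l lel] /= /andP[_ kl].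
    by rewrite /f' -size_eq0 size_drop subn_eq0 -ltnNge kl mul1r.
  - by move=> k l /andP[_ /ltnW].
  move=> a b c <-; rewrite /f' !size_cat.
  case: c b => [|x c] [|y b] /=; rewrite ?mul0r ?B0 ?mulr0 // => /negP[]; lia.
suff -> : rins B A w = csum (fun a => csum (f' a)) w + mu A B w by rewrite addrAC.
rewrite muE -csumD /rins; apply: eq_csum => a v _.
elim/last_ind: v => [|v x _] /=; first by rewrite /f' /= !addr0 cats0 mul0r add0r.
rewrite !csumE !big_ord_recr /= !take_size !drop_size rflex0 /f' eqxx mul0r addr0 cats0.
congr (_ + _); apply: eq_bigr => i _.
by rewrite -[_ == [::]]size_eq0 size_drop subn_eq0 -ltnNge ltn_ord mul1r.
Qed.

Lemma rflexD b c c' : rflex (rflex b c') (rflex c c') = rflex b (c ++ c').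
Proof.
rewrite /rflex -map_comp; apply: eq_map => x /=.
by case: c => [|y c] /=; [rewrite subr0 | ring].
Qed.

Lemma rflex_cat a b c : rflex (a ++ b) c = rflex a c ++ rflex b c.
Proof. exact: map_cat. Qed.

Lemma lflex_rflex a b c : a != [::] -> lflex (rflex a c) (rflex b c) = lflex a b.
Proof.
case/lastP: a => // a x _; rewrite /lflex /rflex map_rcons !last_rcons -map_comp.
by apply: eq_map => y /=; ring.
Qed.

Lemma starA A B D w : star (star A B) D w = star A (star B D) w.
Proof.
rewrite /star; under eq_csum => b c _.
  rewrite {1}/rflex csum_map -csumZr; over.
rewrite -csumA; apply: eq_csum => a v _.
rewrite -csumZl; apply: eq_csum => b c bc.
by rewrite -/(rflex _ _) -/(rflex b c) rflexD bc mulrA.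
Qed.

(** The factor b is inserted between a and c, and the product [star D A] cuts [a ++ c] inside a or
    inside c; the junction is counted twice. The correction [star (star D B) A] arises when b lands
    exactly between D and A, since the letter subtracted in D is then the head of b. *)
Lemma rins_star A B D w : rins B (star D A) w =
  star D (rins B A) w + star (rins B D) A w - star (star D B) A w.
Proof.
pose t (E : seq K -> seq K -> seq K -> K) :=
  csum (fun x v => csum (fun y z => E x y z * A z * B (rflex y z)) v) w.
pose T1 := csum (fun x v => csum (fun y z =>
  csum (fun x' x'' => D (rflex x' (x'' ++ z)) * A (x'' ++ z)) x * B (rflex y z)) v) w.
pose T2 := csum (fun x v => csum (fun y z =>
  csum (fun z' z'' => D (rflex (x ++ z') z'') * A z'') z * B (rflex y z)) v) w.
have -> : rins B (star D A) w = T1 + T2 - t (fun x y z => D (rflex x z)).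
  rewrite /T1 /T2 /t -csumD -csumB; apply: eq_csum => x v _.
  rewrite -csumD -csumB; apply: eq_csum => y z _.
  by rewrite /star csum_cat !(mulrBl, mulrDl).
(* If the part x' of A before the insertion is nonempty, its head is the letter subtracted in D,
   with or without y; the two sides differ only at empty x'. *)
have -> : T1 = star D (rins B A) w
    + (t (fun x y z => D (rflex x z)) - t (fun x y z => D (rflex x (y ++ z)))).
  have -> : T1 = csum (fun x => csum (fun x' => csum (fun y z =>
      D (rflex x (x' ++ z)) * A (x' ++ z) * B (rflex y z)))) w.
    rewrite csumA; apply: eq_csum => x v _.
    by rewrite csum_exchange; apply: eq_csum => y z _; rewrite csumZr.
  apply/eqP; rewrite addrC -subr_eq /t -!csumB; apply/eqP; apply: eq_csum => x v _.
  rewrite -csumZl -!csumB csum_nil => [|x' v' xv x0].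
    rewrite -csumZl -csumB; apply: eq_csum => y z yz.
    by rewrite /= yz mulrA.
  rewrite -csumZl -csumB (eq_csum (g := fun _ _ => 0)) ?csum0 // => y z _.
  by rewrite -xv; case: x' {xv} x0 => // s x' _; rewrite mulrA subrr.
(* Here the insertion happens inside D, and [rflexD] lets the flexion by z'' pass through the inner
   one. *)
have -> : T2 = star (rins B D) A w.
  rewrite /T2 /star [RHS](eq_csum (g := fun v z'' => csum (fun x v' => csum
   (fun y z' => D (rflex (x ++ z') z'') * B (rflex y (z' ++ z'')) * A z'') v') v)).
    rewrite -csumA; apply: eq_csum => x v _; rewrite -csumA.
    apply: eq_csum => y z _; rewrite -csumZr; apply: eq_csum => z' z'' <-.
    by rewrite mulrAC.
  move=> v z'' _; rewrite {1}/rflex /rins csum_map -csumZr.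
  apply: eq_csum => x v' _; rewrite csum_map -csumZr; apply: eq_csum => y z' _.
  by rewrite -!/(rflex _ _) -rflex_cat rflexD.
have -> : star (star D B) A w = t (fun x y z => D (rflex x (y ++ z))).
  rewrite starA; apply: eq_csum => x v _; rewrite -csumZl; apply: eq_csum => y z <-.
  by ring.
by ring.
Qed.

(** No correction here: b follows a nonempty a, so at the junction it is appended to D, and a cut
    inside a keeps the letter subtracted in D. *)
Lemma lins_star A B D w : lins B (star D A) w =
  star D (lins B A) w + star (lins B D) A w.
Proof.
pose T1 := csum (fun x v => csum (fun y z => (x != [::])%:R *
  (csum (fun x' x'' => (x'' != [::])%:R * (D (rflex x' x'') * A (x'' ++ z))) x
   * B (lflex x y))) v) w.
pose T2 := csum (fun x v => csum (fun y z => (x != [::])%:R *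
  (csum (fun z' z'' => D (rflex (x ++ z') z'') * A z'') z * B (lflex x y))) v) w.
have -> : lins B (star D A) w = T1 + T2.
  rewrite /T1 /T2 -csumD; apply: eq_csum => x v _.
  rewrite -csumD; apply: eq_csum => y z _.
  case: (altP (x =P [::])) => [|x0]; first by rewrite !mul0r addr0.
  rewrite !mul1r -mulrDl; congr (_ * _); rewrite /star csum_cat addrAC.
  congr (_ + _); rewrite !csumE !big_ord_recr /= !take_size !drop_size.
  rewrite eqxx mul0r addr0 addrK; apply: eq_bigr => i _.
  rewrite -[_ == [::]]size_eq0 size_drop subn_eq0 -ltnNge ltn_ord mul1r.
  have: drop i x != [::] by rewrite -size_eq0 size_drop subn_eq0 -ltnNge.
  by case: (drop i x).
congr (_ + _).
  rewrite /T1 /star /lins [RHS](eq_csum (g := fun x v => csum (fun x' => csum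
    (fun y z => (x' != [::])%:R * (D (rflex x x') * A (x' ++ z))
       * B (lflex (x ++ x') y))) v)).
    rewrite [RHS]csumA; apply: eq_csum => x v _; rewrite csum_exchange.
    apply: eq_csum => y z _; rewrite -csumZr -csumZl.
    apply: eq_csum => x' x'' xx; rewrite xx -xx.
    case: x'' {xx} => [|s x'']; rewrite ?(mul0r, mulr0) //=.
    by case: x' => [|? ?]; rewrite ?mul1r.
  move=> x v _; rewrite -csumZl; apply: eq_csum => x' v' xv.
  rewrite -csumZl; apply: eq_csum => y z _; rewrite -xv.
  case: x' {xv} => [|s x']; rewrite ?(mul0r, mulr0) //= !mul1r mulrA.
  by rewrite /lflex last_cat.
rewrite /T2 /star [RHS](eq_csum (g := fun v z'' => csum (fun x v' => csum
 (fun y z' => (x != [::])%:R * (D (rflex (x ++ z') z'') * B (lflex x y)) * A z'') v') v)).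
  rewrite -csumA; apply: eq_csum => x v _; rewrite -csumA.
  apply: eq_csum => y z _; rewrite -csumZr -csumZl; apply: eq_csum => z' z'' _.
  by ring.
move=> v z'' _; rewrite {1}/rflex /lins csum_map -csumZr.
apply: eq_csum => x v' _; rewrite csum_map -csumZr; apply: eq_csum => y z' _.
rewrite -!/(rflex _ _) -rflex_cat; case: x => [|s x]; first by rewrite !mul0r.
by rewrite lflex_rflex.
Qed.

Lemma preari_star A B D w : B [::] = 0 -> preari (star D A) B w =
  star D (fun v => preari A B v) w + star (theta B D) A w.
Proof.
move=> B0; rewrite preariE // rins_star lins_star.
have -> : star D (fun v => preari A B v) w = star D (rins B A) w - star D (lins B A) w.
  by rewrite -csumB; apply: eq_csum => b c _; rewrite preariE // mulrBr.
have -> : star (theta B D) A w =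
    star (rins B D) A w - star (lins B D) A w - star (star D B) A w.
  by rewrite -!csumB; apply: eq_csum => b c _; rewrite /theta preariE // !mulrBl.
by ring.
Qed.

Lemma theta_star A B D w : B [::] = 0 ->
  theta B (star D A) w = star D (theta B A) w + star (theta B D) A w.
Proof.
move=> B0; rewrite {1}/theta preari_star // starA addrAC; congr (_ + _).
by rewrite /star -csumB; apply: eq_csum => b c _; rewrite /theta -mulrBr.
Qed.

(** The first letter survives every deletion except that of a prefix b. Then the head of c replaces
    that of b, and their difference is minus the head of [rflex b c], which yields [lam B]. For
    empty c this relies on the default head 0. *)
Lemma preari_lam A B w : B [::] = 0 ->
  preari (lam A) B w = lam (fun v => preari A B v) w - star (lam B) A w.
Proof.
move=> B0; rewrite /lam !preariE // mulrBr addrAC; congr (_ - _).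
  apply/eqP; rewrite eq_sym subr_eq addrC -subr_eq; apply/eqP.
  rewrite /rins -csumZl -csumB csum_nil => [|a v aw a0].
    rewrite -csumZl -csumB; apply: eq_csum => b c bc /=; rewrite -bc.
    by case: b {bc} => [|x b] /=; [rewrite B0 | ]; ring.
  rewrite -csumZl -csumB (eq_csum (g := fun _ _ => 0)) ?csum0 // => b c _.
  by rewrite -aw; case: a {aw} a0 => //= x a _; rewrite mulrA subrr.
rewrite /lins -csumZl; apply: eq_csum => a v aw; rewrite -csumZl.
apply: eq_csum => b c _; rewrite -aw; case: a {aw} => [|x a] /=; ring.
Qed.

End Flexions.

(** * A Bernoulli polynomial identity *)

Lemma bin_trinomial n s l : (l <= s <= n)%N ->
  ('C(n, l) * 'C(n - l, s - l) = 'C(n, s) * 'C(s, l))%N.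
Proof.
case/andP=> ls sn; have ln := leq_trans ls sn.
have lsn : (s - l <= n - l)%N by rewrite leq_sub2r.
have fl := fact_gt0 l; have fs := fact_gt0 (s - l); have fn := fact_gt0 (n - s).
have e1 := bin_fact ln; have e2 := bin_fact sn.
have e3 := bin_fact ls; have e4 := bin_fact lsn.
have e5 : (n - l - (s - l) = n - s)%N by lia.
rewrite e5 in e4.
apply/eqP; rewrite -(eqn_pmul2r (m := l`! * (s - l)`! * (n - s)`!)) ?muln_gt0 ?fl ?fs //.
apply/eqP; transitivity n`!; first by rewrite -e1 -e4; ring.
by rewrite -e2 -e3; ring.
Qed.

Section BernoulliPolynomial.
Variables (R : comNzRingType) (b : nat -> R).
Hypothesis sumb : forall n, \sum_(k < n.+1) 'C(n.+1, k)%:R * b k = (n == 0)%:R.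

(* [bern n x z] is [z ^+ n] times the Bernoulli polynomial at [x / z]. *)
Definition bern n (x z : R) : R :=
  \sum_(l < n.+1) 'C(n, l)%:R * b l * z ^+ l * x ^+ (n - l).

(** The difference equation of the Bernoulli polynomials. Expanding and collecting by the power s of
    z, the inner binomial sum is the recurrence [sumb], leaving [b s] plus 1 at s = 1. *)
Lemma bern_shift n x z :
  bern n (x + z) z = bern n x z + n%:R * z * x ^+ n.-1.
Proof.
have -> : bern n (x + z) z = \sum_(s < n.+1) \sum_(l < n.+1 | (l <= s)%N)
    'C(n, s)%:R * z ^+ s * x ^+ (n - s) * ('C(s, l)%:R * b l).
  rewrite (exchange_big_dep xpredT) //=; apply: eq_bigr => -[l ln] _ /=.
  rewrite exprDn mulr_sumr -(big_mkord (fun s => (l <= s)%N) (fun s =>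
    'C(n, s)%:R * z ^+ s * x ^+ (n - s) * ('C(s, l)%:R * b l))).
  rewrite (big_cat_nat (n := l)) //= 1?ltnW //.
  rewrite [X in _ = X + _]big_nat_cond [X in _ = X + _]big_pred0 ?add0r => [|s].
    2: by lia.
  rewrite -[X in \sum_(X <= _ < _ | _) _]add0n big_addn subSn // big_mkord.
  apply: eq_big => [s|[s sn] _ /=]; first by rewrite leq_addl.
  have := @bin_trinomial n (s + l) l; rewrite addnK => /(_ ltac:(lia)).
  move=> /(congr1 (fun k => k%:R : R)); rewrite !natrM => e.
  rewrite subnDA [(n - s - l)%N]subnAC -mulr_natl exprD.
  transitivity ('C(n, l)%:R * 'C(n - l, s)%:R *
      (b l * z ^+ l * (x ^+ (n - l - s) * z ^+ s))).
    by ring.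
  by rewrite e; ring.
have inner (s : nat) : (s < n.+1)%N ->
    \sum_(l < n.+1 | (l <= s)%N) 'C(s, l)%:R * b l = b s + (s == 1)%:R.
  move=> sn; rewrite -(big_ord_widen n.+1 (fun l => 'C(s, l)%:R * b l) sn).
  rewrite big_ord_recr /= binn mul1r addrC; case: s {sn} => [|s].
    by rewrite big_ord0.
  by rewrite sumb.
under eq_bigr => s _ do rewrite -mulr_sumr inner ?ltn_ord // mulrDr.
rewrite big_split /=; congr (_ + _).
  by apply: eq_bigr => s _; ring.
case: n {inner} => [|n]; first by rewrite big_ord1 mulr0 !mul0r.
rewrite (bigD1 (inord 1)) //= inordK // eqxx bin1 expr1 mulr1 subn1 big1 ?addr0 //.
move=> s; rewrite -val_eqE /= inordK // => /negbTE ->; exact: mulr0.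
Qed.

(** The rule B_(n+1)' = (n+1) B_n, homogenised. *)
Lemma bern_deriv n x z : \sum_(l < n.+2)
    ('C(n.+1, l) * (n.+1 - l))%:R * b l * z ^+ l * x ^+ (n - l) =
  n.+1%:R * bern n x z.
Proof.
rewrite big_ord_recr /= subnn muln0 !mul0r addr0 /bern mulr_sumr.
apply: eq_bigr => -[l ln] _ /=.
have e : ('C(n.+1, l) * (n.+1 - l) = n.+1 * 'C(n, l))%N.
  by rewrite mul_bin_down mulnC.
by rewrite e natrM; ring.
Qed.

(** With N = n + 2, write l - 1 = (N - 1) - (N - l). The sum becomes (N - 1)(B_N(y) - B_N(x)) - (y -
    z) B_N'(y) + x B_N'(x). As y - z = x, the difference equations in degrees N and N - 1 make the
    terms cancel. *)
Lemma bern_identity n x y z : y = x + z ->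
  \sum_(l < n.+3) 'C(n.+2, l)%:R * b l *
     ((l%:R - 1) * z ^+ l * (y ^+ (n.+2 - l) - x ^+ (n.+2 - l))
      + (n.+2 - l)%:R * z ^+ l.+1 * y ^+ (n.+1 - l)) = 0.
Proof.
move=> ->; set y' := x + z.
have e (l : 'I_n.+3) : 'C(n.+2, l)%:R * b l *
     ((l%:R - 1) * z ^+ l * (y' ^+ (n.+2 - l) - x ^+ (n.+2 - l))
      + (n.+2 - l)%:R * z ^+ l.+1 * y' ^+ (n.+1 - l)) =
   n.+1%:R * ('C(n.+2, l)%:R * b l * z ^+ l * y' ^+ (n.+2 - l)
            - 'C(n.+2, l)%:R * b l * z ^+ l * x ^+ (n.+2 - l))
   - (y' - z) * (('C(n.+2, l) * (n.+2 - l))%:R * b l * z ^+ l * y' ^+ (n.+1 - l))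
   + x * (('C(n.+2, l) * (n.+2 - l))%:R * b l * z ^+ l * x ^+ (n.+1 - l)).
  case: l => l /= ln; rewrite natrM; have [lt|ge] := ltnP l n.+2; last first.
    have -> : l = n.+2 by lia.
    by rewrite subnn expr0; ring.
  rewrite -[(n.+2 - l)%N]/(n.+2 - l)%N subSn // !exprS.
  have -> : (n.+1%:R : R) = (n.+1 - l)%:R + l%:R by rewrite -natrD subnK.
  by rewrite -[(n.+1 - l).+1]addn1 natrD; ring.
rewrite (eq_bigr _ (fun l _ => e l)) big_split /= sumrB -!mulr_sumr sumrB.
rewrite !bern_deriv -!/(bern _ _ _) /y' !bern_shift /=.
by rewrite exprS -[n.+2]addn1 natrD; ring.
Qed.

End BernoulliPolynomial.

(** * The polynomial identity behind Delta dupil = v_1 dipil *)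

Section PolyIdentity.
Variable K : fieldType.
Hypothesis charK : [pchar K] =i pred0.

Lemma fact_neq0 n : n`!%:R != 0 :> K.
Proof. by rewrite (pcharf0P K).1 // -lt0n fact_gt0. Qed.

Lemma arith_geom_sum r :
  ('X - 1) ^+ 2 * (\sum_(j < r) (j.+1%:R : K) *: 'X^j) =
  (r%:R : K) *: 'X^(r.+1) - (r.+1%:R : K) *: 'X^r + 1.
Proof.
elim: r => [|r IH]; first by rewrite big_ord0 mulr0 scale0r scale1r expr0; ring.
rewrite big_ord_recr /= mulrDr IH -!mul_polyC !polyC_natr.
by rewrite !exprS -[r.+2]addn1 -[r.+1]addn1 !natrD; ring.
Qed.

(** The left side is Delta dupil in depth r, the right side [lam dipil]. Multiplied by
    [('X - 1) ^+ 2] and (r+1)!, it is a case of [bern_identity]. *)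
Lemma bernoulli_poly_sum r : (0 < r)%N ->
  \sum_(i < r) (bernoulli K i.+1 / i.+1`!%:R) *:
     (((r - i)`!%:R^-1 *: (('X - 1) ^+ i.-1 *+ i * ('X^(r - i) - 1)))
      + (r.-1 - i)`!%:R^-1 *: (('X - 1) ^+ i * 'X^(r.-1 - i)))
  = - (r.+1`!%:R^-1 *: \sum_(j < r) j.+1%:R *: 'X^j).
Proof.
case: r => // r _; pose z : {poly K} := 'X - 1.
have z0 : z ^+ 2 != 0 by rewrite /z -polyC1 expf_neq0 // polyXsubC_eq0.
apply: (mulfI z0); rewrite mulrN -scalerAr arith_geom_sum.
have f0 := fact_neq0 r.+2.
apply: (@scalerI _ _ r.+2`!%:R) => //.
rewrite scalerN scalerA mulfV // scale1r.
pose b l : {poly K} := (bernoulli K l)%:P.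
have sb n : \sum_(k < n.+1) 'C(n.+1, k)%:R * b k = (n == 0)%:R.
  under eq_bigr => k _ do rewrite -[_%:R]polyC_natr -polyCM.
  by rewrite -rmorph_sum sum_bernoulli // rmorph_nat.
(* T on the left of I is ['X], T on its right is 1, and their difference z is the commutator. *)
have := bern_identity sb r (x := 1) (y := 'X) (z := z); rewrite /z addrC subrK => /(_ erefl).
(* The last term vanishes; the term l = 0 is the closed form in [arith_geom_sum]. *)
rewrite big_ord_recl big_ord_recr /=.
set S := \sum_(i < _) _.
have -> : (bump 0 r.+1 = r.+2)%N by [].
rewrite subnn !expr0 subrr mulr0 mul0r mul0r addr0 mulr0 addr0.
have -> : b 0%N = 1 by rewrite /b /bernoulli /= polyC1.
rewrite bin0 !subn0 !expr1n expr1 => /eqP; rewrite addrC addr_eq0 => /eqP hS.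
transitivity S; last first.
  by rewrite hS -!mul_polyC !polyC_natr !exprS -[r.+2]addn1 -[r.+1]addn1 !natrD; ring.
rewrite mulr_sumr scaler_sumr; apply: eq_bigr => -[i ir] _ /=.
have -> : (bump 0 i = i.+1)%N by [].
have -> : (r.+2 - i.+1 = r.+1 - i)%N by [].
have -> : (r.+1 - i.+1 = r - i)%N by [].
rewrite expr1n /b.
have [fi fri] : i.+1`!%:R != 0 :> K /\ (r - i)`!%:R != 0 :> K.
  by split; apply: fact_neq0.
have ri0 : (r.+1 - i)%:R != 0 :> K by rewrite (pcharf0P K).1 // -lt0n subn_gt0.
have e : r.+2`!%:R = 'C(r.+2, i.+1)%:R * (i.+1`!%:R * ((r.+1 - i)%:R * (r - i)`!%:R)) :> K.
  rewrite -!natrM; congr (_%:R); have := @bin_fact r.+2 i.+1; rewrite subSS.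
  by rewrite subSn // factS => <- //; rewrite ltnS ltnW.
have fE : (r.+1 - i)`!%:R = (r.+1 - i)%:R * (r - i)`!%:R :> K.
  by rewrite subSn // factS natrM.
rewrite e fE -!mul_polyC.
have -> : 'C(r.+2, i.+1)%:R = ('C(r.+2, i.+1)%:R : K)%:P by rewrite polyC_natr.
have -> : (r.+1 - i)%:R = ((r.+1 - i)%:R : K)%:P by rewrite polyC_natr.
have c1 : 'C(r.+2, i.+1)%:R * (i.+1`!%:R * ((r.+1 - i)%:R * (r - i)`!%:R))
   * (bernoulli K i.+1 / i.+1`!%:R) * ((r.+1 - i)%:R * (r - i)`!%:R)^-1
   = 'C(r.+2, i.+1)%:R * bernoulli K i.+1 by field; rewrite fi fri ri0.
have c2 : 'C(r.+2, i.+1)%:R * (i.+1`!%:R * ((r.+1 - i)%:R * (r - i)`!%:R))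
   * (bernoulli K i.+1 / i.+1`!%:R) * (r - i)`!%:R^-1
   = 'C(r.+2, i.+1)%:R * bernoulli K i.+1 * (r.+1 - i)%:R by field; rewrite fi fri.
move/(congr1 polyC): c1; move/(congr1 polyC): c2; rewrite !(polyCM _ _).
move=> c2 c1.
have zi : ('X - 1) ^+ 2 * (('X - 1) ^+ i.-1 *+ i) = (i.+1%:R - 1) * ('X - 1) ^+ i.+1
    :> {poly K}.
  case: i {ir fi fri ri0 e fE c1 c2} => [|i]; first by rewrite mulr0n; ring.
  by rewrite -[i.+2]addn1 natrD addrK -[_ ^+ _ *+ _]mulr_natl addn1 /= !exprS; ring.
have -> : forall C F G B' Fi FGi Gi P2 P1 Y Pi W : {poly K},
    C * (F * G) * (P2 * (B' * Fi * (FGi * (P1 * Y) + Gi * (Pi * W)))) =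
    C * (F * G) * (B' * Fi) * FGi * (P2 * P1 * Y)
    + C * (F * G) * (B' * Fi) * Gi * (P2 * Pi * W) by move=> *; ring.
by rewrite c1 c2 zi !exprS; ring.
Qed.
End PolyIdentity.

(** * Linearity and locality of theta *)

Section Theta.
Variable K : fieldType.
Implicit Types (A B D M : mould K) (a b c w u v : seq K).

Lemma theta_lin B k A D w : B [::] = 0 ->
  theta B (fun v => k * A v + D v) w = k * theta B A w + theta B D w.
Proof.
move=> B0; rewrite /theta !preariE //.
have -> : rins B (fun v => k * A v + D v) w = k * rins B A w + rins B D w.
  rewrite /rins -csumZl -csumD; apply: eq_csum => a v _.
  by rewrite -csumZl -csumD; apply: eq_csum => b c _; ring.
have -> : lins B (fun v => k * A v + D v) w = k * lins B A w + lins B D w.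
  rewrite /lins -csumZl -csumD; apply: eq_csum => a v _.
  by rewrite -csumZl -csumD; apply: eq_csum => b c _; ring.
have -> : star (fun v => k * A v + D v) B w = k * star A B w + star D B w.
  by rewrite /star -csumZl -csumD; apply: eq_csum => b c _; ring.
by ring.
Qed.

Lemma eq_theta B A D w : B [::] = 0 ->
  (forall v, (size v <= size w)%N -> A v = D v) -> theta B A w = theta B D w.
Proof.
move=> B0 AD; rewrite /theta !preariE //; congr (_ - _ - _).
- apply: eq_csum => a v aw; apply: eq_csum => b c vE.
  by rewrite AD // -aw -vE !size_cat; lia.
- apply: eq_csum => a v aw; apply: eq_csum => b c vE.
  by rewrite AD // -aw -vE !size_cat; lia.
by apply: eq_csum => b c bc; rewrite AD // -bc size_map size_cat leq_addr.
Qed.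

Lemma theta_sum B n (k : nat -> K) (A : nat -> mould K) w : B [::] = 0 ->
  theta B (fun v => \sum_(i < n) k i * A i v) w = \sum_(i < n) k i * theta B (A i) w.
Proof.
move=> B0; elim: n => [|n IH].
  rewrite big_ord0 -[RHS](addNr (theta B (A 0) w)) -mulN1r -theta_lin //.
  by apply: eq_theta => // v _; rewrite big_ord0; ring.
rewrite big_ord_recr /= addrC -IH -theta_lin //.
by apply: eq_theta => // v _; rewrite big_ord_recr addrC.
Qed.

End Theta.

(** * Moulds with only the poles v_i - v_(i+1) and v_r *)

Section Flat.
Variable K : fieldType.
Implicit Types (A B D M : mould K) (a b c w u v s t : seq K) (p q : {poly K}).

(* The letters of a v-word with 0 adjoined are distinct, so that no flexion of *)
(* it meets a pole.                                                            *)
Definition good w := uniq (0 :: w).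

(** Recovers the letters [u_r, ..., u_1] from the swapped word ([dif_psums]). *)
Fixpoint dif w : seq K := if w is x :: v then (x - head 0 v) :: dif v else [::].

Definition invdif w : K := (\prod_(x <- dif w) x)^-1.

(* In depth r, [ev 'X^j] is the product T^j I T^(r-1-j), read along the v-word. *)
Definition evs p s : K := \sum_(j < size s) p`_j * s`_j.

Definition ev p w : K := invdif w * evs p (dif w).

Lemma size_dif w : size (dif w) = size w.
Proof. by elim: w => //= x w ->. Qed.

Lemma dif_cat b c : dif (b ++ c) = dif (rflex b c) ++ dif c.
Proof.
elim: b => //= x b ->; congr (_ :: _).
by case: b => [|y b] /=; [rewrite subr0 | ring].
Qed.

Lemma invdif_cat b c : invdif (b ++ c) = invdif (rflex b c) * invdif c.
Proof. by rewrite /invdif dif_cat big_cat invfM. Qed.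

Lemma good_catr b c : good (b ++ c) -> good c.
Proof.
rewrite /good /= mem_cat negb_or cat_uniq => /andP[/andP[_ ->]].
by case/and3P.
Qed.

Lemma good_catC b c : good (b ++ c) = good (c ++ b).
Proof. by rewrite /good /= !mem_cat orbC uniq_catC. Qed.

Lemma good_catl b c : good (b ++ c) -> good b.
Proof. by rewrite good_catC; apply: good_catr. Qed.

Lemma good_rflex b c : good (b ++ c) -> good (rflex b c).
Proof.
move=> g; rewrite /good /= map_inj_uniq; last exact: addIr.
have := good_catl g; rewrite {1}/good /= => /andP[b0 ->]; rewrite andbT.
apply/negP => /mapP[x xb /esym/eqP]; rewrite subr_eq0 => /eqP e.
case: c g e => [|y c] g e; first by rewrite /= e in xb; rewrite xb in b0.
move: g; rewrite /good /= cat_uniq => /and4P[_ _ /hasPn/(_ y (mem_head _ _))/negP[]].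
by move: e => /= <-.
Qed.

Lemma good_del a b c : good (a ++ b ++ c) -> good (a ++ c).
Proof.
by rewrite catA good_catC catA => /good_catl; rewrite good_catC.
Qed.

Lemma prod_dif_neq0 w : good w -> \prod_(x <- dif w) x != 0.
Proof.
elim: w => [|x w IH] g; first by rewrite big_nil oner_neq0.
rewrite big_cons mulf_neq0 ?IH //; last exact: (@good_catr [:: x]).
rewrite subr_eq0; apply: contraTneq g => ->.
by case: w {IH} => [|y w]; rewrite /good /= ?inE eqxx ?andbF.
Qed.

Lemma eq_star A A' B B' w : good w ->
  (forall v, good v -> A v = A' v) -> (forall v, good v -> B v = B' v) ->
  star A B w = star A' B' w.
Proof.
move=> g AA BB; apply: eq_csum => b c bc; rewrite -bc in g.
by rewrite AA ?BB //; [exact: good_catr g | exact: good_rflex].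
Qed.

Lemma evsD p q s : evs (p + q) s = evs p s + evs q s.
Proof. by rewrite -big_split; apply: eq_bigr => i _; rewrite coefD mulrDl. Qed.

Lemma evsZ k p s : evs (k *: p) s = k * evs p s.
Proof. by rewrite mulr_sumr; apply: eq_bigr => i _; rewrite coefZ mulrA. Qed.

Lemma evs0 s : evs 0 s = 0.
Proof. by rewrite /evs big1 // => i _; rewrite coef0 mul0r. Qed.

Lemma evs_catl p s t : (size p <= size s)%N -> evs p (s ++ t) = evs p s.
Proof.
move=> ps; rewrite /evs size_cat big_split_ord /= [X in _ + X]big1 ?addr0 => [|i _].
  by apply: eq_bigr => i _; rewrite nth_cat ltn_ord.
by rewrite nth_default ?mul0r // (leq_trans ps) // leq_addr.
Qed.

Lemma evs_catr p s t : evs ('X^(size s) * p) (s ++ t) = evs p t.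
Proof.
rewrite /evs size_cat big_split_ord /= big1 ?add0r => [|i _].
  apply: eq_bigr => i _.
  by rewrite coefXnM nth_cat ltnNge leq_addr /= addKn.
by rewrite coefXnM ltn_ord mul0r.
Qed.

Lemma ev0 w : ev 0 w = 0.
Proof. by rewrite /ev evs0 mulr0. Qed.

Lemma evD p q w : ev (p + q) w = ev p w + ev q w.
Proof. by rewrite /ev evsD mulrDr. Qed.

Lemma evZ k p w : ev (k *: p) w = k * ev p w.
Proof. by rewrite /ev evsZ mulrCA. Qed.

Lemma evB p q w : ev (p - q) w = ev p w - ev q w.
Proof. by rewrite evD -scaleN1r evZ mulN1r. Qed.

Lemma ev_sum n (F : nat -> {poly K}) w :
  ev (\sum_(i < n) F i) w = \sum_(i < n) ev (F i) w.
Proof.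
by elim: n => [|n IH]; rewrite ?big_ord0 ?ev0 // !big_ord_recr /= evD IH.
Qed.

(** The power series in T with coefficients k, since [invdif] is T^r in depth r. *)
Definition flat (k : nat -> K) : mould K := fun w => k (size w) * invdif w.

Definition fam (f : nat -> {poly K}) : mould K := fun w => ev (f (size w)) w.

(** Left multiplication by T is multiplication by ['X]. *)
Lemma ev_catr p b c :
  ev ('X^(size b) * p) (b ++ c) = invdif (rflex b c) * ev p c.
Proof.
rewrite /ev invdif_cat dif_cat -mulrA; congr (_ * (_ * _)).
by rewrite -(size_map (fun x => x - head 0 c) b) -size_dif evs_catr.
Qed.

(** Right multiplication by T acts as 1; the degree bound keeps the coefficients off the letters of
    c. *)
Lemma ev_catl p b c : (size p <= size b)%N ->
  ev p (b ++ c) = ev p (rflex b c) * invdif c.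
Proof.
by move=> pb; rewrite /ev invdif_cat dif_cat evs_catl ?size_dif ?size_map 1?mulrAC.
Qed.

Lemma star_flat_fam k f w : star (flat k) (fam f) w =
  ev (\sum_(i < (size w).+1) k i *: ('X^i * f (size w - i)%N)) w.
Proof.
rewrite (ev_sum _ (fun i => k i *: ('X^i * f (size w - i)%N))).
transitivity (csum (fun b c =>
    ev (k (size b) *: ('X^(size b) * f (size w - size b)%N)) w) w).
  apply: eq_csum => b c <-; rewrite evZ ev_catr /flat /fam size_map size_cat addKn.
  by rewrite -mulrA.
by rewrite csumE; apply: eq_bigr => -[i iw] _ /=; rewrite size_takel.
Qed.

Lemma star_fam_flat (k : nat -> K) (f : nat -> {poly K}) w :
  (forall n, (size (f n) <= n)%N) ->
  star (fam f) (flat k) w =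
  ev (\sum_(i < (size w).+1) k (size w - i)%N *: f i) w.
Proof.
move=> sf; rewrite (ev_sum _ (fun i => k (size w - i)%N *: f i)).
transitivity (csum (fun b c => ev (k (size w - size b)%N *: f (size b)) w) w).
  apply: eq_csum => b c <-; rewrite evZ ev_catl ?sf // /flat /fam size_map size_cat addKn.
  by rewrite mulrCA.
by rewrite csumE; apply: eq_bigr => -[i iw] _ /=; rewrite size_takel.
Qed.

End Flat.

(** * The flexions of dipil *)

Section Dipil.
Variable K : fieldType.
Hypothesis charK : [pchar K] =i pred0.
Implicit Types (A B D M : mould K) (a b c w u v s t : seq K) (p q : {poly K}).

Lemma natr_neq0 n : n.+1%:R != 0 :> K.
Proof. by rewrite (pcharf0P K).1. Qed.

Lemma prod_dif x v :
  \prod_(i < size v) ((x :: v)`_i - (x :: v)`_i.+1) * (x :: v)`_(size v) =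
  \prod_(y <- dif (x :: v)) y.
Proof.
elim: v x => [|y v IH] x; first by rewrite big_ord0 mul1r big_cons big_nil mulr1 /= subr0.
by rewrite big_ord_recl -mulrA IH [RHS]big_cons.
Qed.

Lemma dipilE v : dipil v =
  - ((size v).+1)`!%:R^-1 * (\sum_(y <- v) y) * invdif v / head 0 v.
Proof.
case: v => [|x v]; first by rewrite big_nil mulr0 !mul0r.
rewrite /dipil [size (x :: v)]/= [_.-1]/= -[_`_0 * _ * _]mulrA prod_dif /invdif invfM.
by rewrite mulN1r /=; ring.
Qed.

Lemma sum_map_subr (y : K) s : \sum_(x <- [seq x - y | x <- s]) x =
  \sum_(x <- s) x - (size s)%:R * y.
Proof.
elim: s => [|x s IH]; first by rewrite !big_nil mul0r subr0.
by rewrite /= !big_cons IH -[(size s).+1]addn1 natrD; ring.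
Qed.

Lemma dif_rcons w y : dif (rcons w y) = rcons (dif (rflex w [:: y])) y.
Proof. by rewrite -!cats1 dif_cat /= subr0. Qed.

(** Only the cuts leaving a single letter to A survive: two in [rins], one in [lins], one in
    [star]. *)
Lemma theta_depth1 B A x m y : B [::] = 0 ->
  (forall v, size v != 1%N -> A v = 0) ->
  theta B A (x :: rcons m y) =
    A [:: y] * B (rflex (x :: m) [:: y]) + A [:: x] * B (rcons m y)
    - A [:: x] * B (lflex [:: x] (rcons m y))
    - A [:: x - head 0 (rcons m y)] * B (rcons m y).
Proof.
move=> B0 A1; rewrite /theta preariE //.
have csumx (f : seq K -> seq K -> K) : (forall a b, (1 < size a)%N -> f a b = 0) ->
   csum f (x :: rcons m y) = f [::] (x :: rcons m y) + f [:: x] (rcons m y).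
  move=> f0 /=; congr (_ + _); rewrite csum_nil // => -[|z a] b _ // _.
  exact: f0.
have -> : rins B A (x :: rcons m y) =
    A [:: y] * B (rflex (x :: m) [:: y]) + A [:: x] * B (rcons m y).
  rewrite /rins csumx => [|a v a1].
    congr (_ + _).
      rewrite -rcons_cons csum_rcons csum_last => [|b c _ c0].
        by rewrite /= (A1 [::]) // mul0r addr0.
      by rewrite A1 ?mul0r //= size_rcons; case: c c0.
    rewrite csum_last => [|b c _ c0]; first by rewrite rflex0.
    by rewrite A1 ?mul0r //; case: c c0.
  rewrite (eq_csum (g := fun _ _ => 0)) ?csum0 // => b c _.
  by rewrite A1 ?mul0r // size_cat; lia.
have -> : lins B A (x :: rcons m y) = A [:: x] * B (lflex [:: x] (rcons m y)).
  rewrite /lins csumx => [|a v a1].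
    rewrite (eq_csum (g := fun _ _ => 0)) ?csum0 ?add0r => [|b c _]; last by rewrite mul0r.
    rewrite csum_last ?mul1r // => b c _ c0.
    by rewrite A1 ?mul0r ?mulr0 //; case: c c0.
  rewrite (eq_csum (g := fun _ _ => 0)) ?csum0 // => b c _.
  by rewrite A1 ?mul0r ?mulr0 // size_cat; lia.
rewrite /star csumx => [|a b a1]; last by rewrite A1 ?mul0r // size_map; case: (size a) a1 => [|[]].
by rewrite (A1 (rflex [::] _)) // mul0r add0r.
Qed.

Lemma theta_small B A w : B [::] = 0 -> A [::] = 0 -> (size w <= 1)%N ->
  theta B A w = 0.
Proof.
move=> B0 A0; rewrite /theta => w1; rewrite preariE //.
case: w w1 => [|x [|y w]] // _; rewrite /rins /lins /star /= ?B0 ?A0; ring.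
Qed.

(** Puts all values of [dipil] met in [theta_depth1] over common quantities, so that [field] can
    finish in every depth at once. *)
Lemma dipil_flexions x m y : good (x :: rcons m y) ->
  let w := x :: rcons m y in
  let h := head 0 (rcons m y) in
  let P := \prod_(z <- dif (rflex m [:: y])) z in
  let S := \sum_(z <- m) z in
  let k : K := (size m).+1%:R in
  let g : K := - ((size m).+2)`!%:R^-1 in
  [/\ [&& x != 0, y != 0, h != 0, P != 0, x - y != 0 & x - h != 0],
      invdif w = ((x - h) * P * y)^-1,
      dipil (rflex (x :: m) [:: y]) = g * (x + S - k * y) / ((x - h) * P) / (x - y),
      dipil (rcons m y) = g * (S + y) / (P * y) / h &
      dipil (lflex [:: x] (rcons m y)) =
        g * (S + y - k * x) / (P * (y - x)) / (h - x)].
Proof.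
move=> gw w h P S k g; rewrite {}/w {}/k {}/g.
have hE : h = head y m by rewrite /h; case: (m).
have invE : invdif (x :: rcons m y) = ((x - h) * P * y)^-1.
  rewrite /invdif /= big_cons dif_rcons -[rcons (dif _) y]cats1 big_cat big_seq1 /= mulrA.
  by rewrite -/h -/P.
have nz : [&& x != 0, y != 0, h != 0, P != 0, x - y != 0 & x - h != 0].
  have : invdif (x :: rcons m y) != 0 by rewrite invr_eq0 prod_dif_neq0.
  rewrite invE.
  rewrite invr_eq0 !mulf_eq0 !negb_or => /andP[/andP[-> ->] ->].
  rewrite !andbT /= subr_eq0; move: gw.
  rewrite /good /= inE negb_or eq_sym => /and3P[/andP[-> m0] xm _].
  apply/and3P; split => //.
    by apply: contraNneq m0 => <-; rewrite /h; case: (m) => [|z m']; apply: mem_head.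
  by apply: contraNneq xm => ->; rewrite mem_rcons mem_head.
have [/and5P[_ y0 h0 P0 /andP[xy0 xh0]]] := nz.
split => //.
(* The denominator of the flexed word comes from cancelling the factor of y in [invE]. *)
- have := invE; rewrite -rcons_cons -cats1 invdif_cat.
  have -> : invdif [:: y] = y^-1 by rewrite /invdif /= big_seq1 subr0.
  rewrite invfM => /(mulIf _) <-; last by rewrite invr_eq0.
  by rewrite dipilE size_map sum_map_subr big_cons /= -/S.
- rewrite dipilE -/h size_rcons -cats1 big_cat big_seq1 /=; congr (_ * _ / _).
  by rewrite cats1 /invdif dif_rcons -cats1 big_cat big_seq1.
have -> : lflex [:: x] (rcons m y) = rflex (rcons m y) [:: x] by [].
rewrite dipilE size_map sum_map_subr size_rcons -[rcons m y]cats1 big_cat big_seq1 /=.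
congr (_ * _ / _); last by rewrite hE; case: (m).
rewrite /invdif rflex_cat dif_cat rflexD big_cat /= big_seq1 subr0.
by [].
Qed.

End Dipil.

(** * Delta on the generators T and I *)

Section Delta.
Variable K : fieldType.
Hypothesis charK : [pchar K] =i pred0.
Implicit Types (A B D M : mould K) (a b c w u v s t : seq K) (p q : {poly K}).

Definition delta A : mould K := fun w => der A w - theta dipil A w.

Definition letterT : mould K := flat (fun n => (n == 1)%:R).

(* [adI i] is the i-fold commutator [T, [T, .. [T, I]]]: the commutator with T  *)
(* is multiplication by ['X - 1] on polynomials.                                *)
Definition adI_fam (i n : nat) : {poly K} :=
  if n == i.+1 then ('X - 1) ^+ i else 0.

Definition adI i : mould K := fam (adI_fam i).

Definition expm1 (n : nat) : K := if n is 0 then 0 else n`!%:R^-1.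

Lemma letterT_nil : letterT [::] = 0.
Proof. exact: mul0r. Qed.

Lemma adI_nil i : adI i [::] = 0.
Proof. by rewrite /adI /fam ev0. Qed.

Lemma letterT1 (x : K) : letterT [:: x] = x^-1.
Proof. by rewrite /letterT /flat /invdif /= big_seq1 subr0 mul1r. Qed.

Lemma adI1 (x : K) : x != 0 -> adI 0 [:: x] = 1.
Proof.
move=> x0; rewrite /adI /fam /ev /evs /invdif /= big_seq1 big_ord1 /= subr0.
by rewrite /adI_fam eqxx expr0 coef1 mul1r mulVf.
Qed.

Lemma seq2_ind (P : seq K -> Prop) : P [::] -> (forall x, P [:: x]) ->
  (forall x m y, P (x :: rcons m y)) -> forall w, P w.
Proof.
by move=> P0 P1 P2 [|x w] //; case/lastP: w => [|m y].
Qed.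

Lemma delta_letterT w : good w -> delta letterT w = flat expm1 w.
Proof.
elim/seq2_ind: w => [_|x _|x m y gw]; rewrite /delta.
- by rewrite theta_small ?letterT_nil // /der letterT_nil mul0rn subr0 /flat mul0r.
- by rewrite theta_small ?letterT_nil // subr0 /der /letterT /flat /expm1 (_ : 1`! = 1%N) // invr1.
have [/and5P[x0 y0 h0 P0 /andP[xy0 xh0]] wE d1 d2 d3] := dipil_flexions gw.
rewrite theta_depth1 //; last by move=> v /negbTE v1; rewrite /letterT /flat v1 mul0r.
rewrite !letterT1 d1 d2 d3 /der /flat wE /expm1 /= size_rcons.
rewrite /letterT /flat /= size_rcons /= mul0r mul0rn sub0r.
set h := head 0 (rcons m y) in wE h0 xh0 d1 d2 d3 *.
set P := \prod_(z <- _) z in wE P0 d1 d2 d3 *.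
set S := \sum_(z <- m) z; set k := (size m).+1%:R; set g := _`!%:R^-1.
have yx0 : y - x != 0 by rewrite -opprB oppr_eq0.
have hx0 : h - x != 0 by rewrite -opprB oppr_eq0.
by field; rewrite ?x0 ?y0 ?h0 ?P0 ?xy0 ?xh0 ?yx0 ?hx0.
Qed.

Lemma delta_adI0 w : good w -> delta (adI 0) w =
  fam (fun n => if n is k.+1 then k`!%:R^-1 *: 'X^k else 0) w.
Proof.
elim/seq2_ind: w => [_|x gx|x m y gw]; rewrite /delta.
- by rewrite theta_small ?adI_nil // /der adI_nil mul0rn subr0 /fam ev0.
- rewrite theta_small ?adI_nil // subr0 /der /adI /fam /adI_fam /=.
  by rewrite fact0 invr1 scale1r.
have [/and5P[x0 y0 h0 P0 /andP[xy0 xh0]] wE d1 d2 d3] := dipil_flexions gw.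
rewrite theta_depth1 //; last first.
  by move=> v /negbTE v1; rewrite /adI /fam /adI_fam v1 ev0.
rewrite !adI1 // d1 d2 d3 /der /fam /= size_rcons evZ /ev wE.
rewrite {1}/adI /fam /adI_fam /= size_rcons /= ev0 mul0rn sub0r.
have -> : evs 'X^((size m).+1) (dif (x :: rcons m y)) = y.
  rewrite -rcons_cons dif_rcons -cats1.
  have <- : size (dif (rflex (x :: m) [:: y])) = (size m).+1 by rewrite size_dif size_map.
  by rewrite -['X^_]mulr1 evs_catr /evs big_ord1 coef1 mul1r.
set h := head 0 (rcons m y) in wE h0 xh0 d1 d2 d3 *.
set P := \prod_(z <- _) z in wE P0 d1 d2 d3 *.
set S := \sum_(z <- m) z.
(* Brings both factorials to the one occurring in [dipil], which then stays symbolic. *)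
have -> : ((size m).+1`!%:R : K)^-1 = (size m).+2%:R * (size m).+2`!%:R^-1.
  by rewrite [(size m).+2`!]factS natrM invfM mulrA mulfV ?mul1r ?natr_neq0.
rewrite -[(size m).+2]addn1 natrD addn1; set k := (size m).+1%:R; set g := _`!%:R^-1.
have yx0 : y - x != 0 by rewrite -opprB oppr_eq0.
have hx0 : h - x != 0 by rewrite -opprB oppr_eq0.
by field; rewrite ?x0 ?y0 ?h0 ?P0 ?xy0 ?xh0 ?yx0 ?hx0.
Qed.

End Delta.

(** * Delta on iterated commutators *)

Section DeltaD.
Variable K : fieldType.
Hypothesis charK : [pchar K] =i pred0.
Implicit Types (A B D M : mould K) (a b c w u v s t : seq K) (p q : {poly K}).

Lemma der_star A D w : der (star D A) w = star D (der A) w + star (der D) A w.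
Proof.
rewrite /der -mulr_natl -csumZl -csumD; apply: eq_csum => b c <-.
by rewrite size_cat size_map natrD mulrDl addrC !mulr_natl mulrnAr mulrnAl.
Qed.

Lemma delta_star A D w :
  delta (star D A) w = star D (delta A) w + star (delta D) A w.
Proof.
rewrite /delta der_star theta_star //.
have -> : star D (fun v => der A v - theta dipil A v) w =
    star D (der A) w - star D (theta dipil A) w.
  by rewrite -csumB; apply: eq_csum => b c _; rewrite mulrBr.
have -> : star (fun v => der D v - theta dipil D v) A w =
    star (der D) A w - star (theta dipil D) A w.
  by rewrite -csumB; apply: eq_csum => b c _; rewrite mulrBl.
by ring.
Qed.

Lemma star_letterT_fam (f : nat -> {poly K}) w :
  star (@letterT K) (fam f) w = if size w is n.+1 then ev ('X * f n) w else 0.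
Proof.
rewrite star_flat_fam; case E: (size w) => [|n].
  by rewrite big_ord1 scale0r ev0.
rewrite (bigD1 (inord 1)) //= inordK // scale1r subn1 big1 ?addr0 // => j.
by rewrite -val_eqE /= inordK // => /negbTE ->; rewrite scale0r.
Qed.

Lemma star_fam_letterT (f : nat -> {poly K}) w : (forall n, (size (f n) <= n)%N) ->
  star (fam f) (@letterT K) w = if size w is n.+1 then ev (f n) w else 0.
Proof.
move=> sf; rewrite star_fam_flat //; case E: (size w) => [|n].
  by rewrite big_ord1 scale0r ev0.
rewrite (bigD1 (inord n)) //= inordK // subSnn scale1r big1 ?addr0 // => -[j jn].
rewrite -val_eqE /= inordK // => nj.
by rewrite (_ : (n.+1 - j == 1)%N = false) ?scale0r //; apply/eqP; move/eqP: nj; lia.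
Qed.

Lemma size_XsubC_exp i : size (('X - 1 : {poly K}) ^+ i) = i.+1.
Proof. by rewrite -polyC1 size_exp_XsubC. Qed.

Lemma size_adI_fam i n : (size (adI_fam K i n) <= n)%N.
Proof.
by rewrite /adI_fam; case: eqP => [->|_]; rewrite ?size_XsubC_exp ?size_poly0.
Qed.

Lemma adI_rec i w :
  @adI K i.+1 w = star (@letterT K) (@adI K i) w - star (@adI K i) (@letterT K) w.
Proof.
rewrite star_letterT_fam star_fam_letterT => [|n]; last exact: size_adI_fam.
rewrite /adI {1}/fam; case: (size w) => [|n]; first by rewrite ev0 subr0.
rewrite -evB /adI_fam eqSS; case: eqP => _; last by rewrite mulr0 subr0.
by rewrite exprS mulrBl mul1r.
Qed.

(** Depth n of i [exp(T) - 1, ad_T^(i-1) I] + ad_T^i (exp(T) I); at i = 0 the factor [*+ i] kills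
    the first part. *)
Definition delta_adI_fam (i n : nat) : {poly K} :=
  if (i < n)%N then
    (n - i)`!%:R^-1 *: (('X - 1) ^+ i.-1 *+ i * ('X^(n - i) - 1))
    + (n.-1 - i)`!%:R^-1 *: (('X - 1) ^+ i * 'X^(n.-1 - i))
  else 0.

Lemma size_delta_adI_fam i n : (size (delta_adI_fam i n) <= n)%N.
Proof.
rewrite /delta_adI_fam; case: ifP => [lin|_]; last by rewrite size_poly0.
rewrite (leq_trans (size_polyD _ _)) // geq_max; apply/andP; split;
  rewrite (leq_trans (size_scale_leq _ _)) //.
  case: i lin => [|i] lin; first by rewrite mulr0n mul0r size_poly0.
  rewrite (leq_trans (size_polyMleq _ _)) //= -scaler_nat.
  have := size_scale_leq (i.+1%:R : K) (('X - 1) ^+ i).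
  rewrite size_XsubC_exp -polyC1 size_XnsubC ?subn_gt0 //=.
  by move: (size _) => k; lia.
by rewrite (leq_trans (size_polyMleq _ _)) // size_XsubC_exp size_polyXn; lia.
Qed.

Lemma star_expm1_adI i w : star (flat (expm1 K)) (@adI K i) w =
  if (i < size w)%N then
    ev (expm1 K (size w - i.+1) *: ('X^(size w - i.+1) * ('X - 1) ^+ i)) w else 0.
Proof.
rewrite star_flat_fam; case: ifP => iw.
  rewrite (bigD1 (inord (size w - i.+1))) //= inordK ?ltnS ?leq_subr //.
  rewrite big1 ?addr0 => [|[j jw]]; first by rewrite /adI_fam subKn // eqxx.
  rewrite -val_eqE /= inordK ?ltnS ?leq_subr // => ji.
  by rewrite /adI_fam ifN ?mulr0 ?scaler0 //; apply: contra ji => /eqP; lia.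
rewrite big1 ?ev0 // => -[j jw] _ /=.
by rewrite /adI_fam ifN ?mulr0 ?scaler0 //; apply: contraFN iw => /eqP; lia.
Qed.

Lemma star_adI_expm1 i w : star (@adI K i) (flat (expm1 K)) w =
  if (i < size w)%N then
    ev (expm1 K (size w - i.+1) *: ('X - 1) ^+ i) w else 0.
Proof.
rewrite star_fam_flat => [|n]; last exact: size_adI_fam; case: ifP => iw.
  rewrite (bigD1 (inord i.+1)) //= inordK //.
  rewrite big1 ?addr0 => [|[j jw]]; first by rewrite /adI_fam eqxx.
  rewrite -val_eqE /= inordK // => ji.
  by rewrite /adI_fam ifN ?scaler0.
rewrite big1 ?ev0 // => -[j jw] _ /=.
by rewrite /adI_fam ifN ?scaler0 //; apply: contraFN iw => /eqP; lia.
Qed.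

Lemma delta_adI i w : good w -> delta (@adI K i) w = fam (delta_adI_fam i) w.
Proof.
elim: i w => [|i IH] w gw.
  rewrite delta_adI0 //; rewrite /fam /delta_adI_fam; case: (size w) => //= n.
  by rewrite mulr0n mul0r scaler0 add0r expr0 mul1r subn0.
have -> : delta (@adI K i.+1) w = delta (star (@letterT K) (@adI K i)) w
                              - delta (star (@adI K i) (@letterT K)) w.
  rewrite /delta /der adI_rec.
  rewrite (@eq_theta _ _ _ (fun v => -1 * star (@adI K i) (@letterT K) v
      + star (@letterT K) (@adI K i) v)) //; last first.
    by move=> v _; rewrite adI_rec; ring.
  by rewrite theta_lin // mulrnBl; ring.
rewrite !delta_star.
rewrite (@eq_star _ _ (@letterT K) (delta (@adI K i)) (fam (delta_adI_fam i))) //.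
rewrite (@eq_star _ (delta (@adI K i)) (fam (delta_adI_fam i)) (@letterT K) (@letterT K)) //.
rewrite (@eq_star _ (delta (@letterT K)) (flat (expm1 K)) (@adI K i) (@adI K i)) //; last first.
  by move=> v gv; apply: delta_letterT.
rewrite (@eq_star _ (@adI K i) (@adI K i) (delta (@letterT K)) (flat (expm1 K))) //; last first.
  by move=> v gv; apply: delta_letterT.
rewrite star_letterT_fam star_fam_letterT => [|n]; last exact: size_delta_adI_fam.
rewrite star_expm1_adI star_adI_expm1 /fam.
case: (size w) => [|m]; first by rewrite /delta_adI_fam !ltn0 !ev0; ring.
rewrite /delta_adI_fam !ltnS; case: (ltngtP i m) => [im|mi|->] /=.
- rewrite -!evD -evB; congr (ev _ w); rewrite !subSS.
  have -> : expm1 K (m - i) = (m - i)`!%:R^-1.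
    by rewrite /expm1; case E: (m - i)%N => //; move: E; lia.
  have -> : (m.-1 - i = m - i.+1)%N by lia.
  have zi : ('X - 1) * (('X - 1) ^+ i.-1 *+ i) = ('X - 1) ^+ i *+ i :> {poly K}.
    by case: (i) => [|k]; rewrite ?mulr0n ?mulr0 // mulrnAr -exprS.
  (* The commutator with Delta T contributes one more copy of the first part, turning i into i +
     1. *)
  rewrite mulrSr -zi exprS -!mul_polyC; ring.
- by rewrite mulr0 ev0; ring.
by rewrite subnn /= scale0r mulr0 scale0r !ev0; ring.
Qed.

End DeltaD.

(** * The recursion of pal for swap pil *)

Section Main.
Variable K : fieldType.
Hypothesis charK : [pchar K] =i pred0.
Implicit Types (A B D M : mould K) (a b c w u v s t : seq K) (p q : {poly K}).

(** The series of B_r / r! times ad_T^(r-1) I, as [dupil_adI] spells out. *)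
Definition dupil : mould K := fun w =>
  bernoulli K (size w) / (size w)`!%:R * ev (('X - 1) ^+ (size w).-1) w.

Lemma dupil_nil : dupil [::] = 0.
Proof. by rewrite /dupil /ev /evs big_ord0 !mulr0. Qed.

Lemma dupil_adI n v : (size v <= n)%N ->
  dupil v = \sum_(i < n) bernoulli K i.+1 / i.+1`!%:R * adI i v.
Proof.
move=> vn; rewrite /adI /fam /adI_fam; case E: (size v) vn => [|r] vn.
  rewrite big1 => [|i _]; last by rewrite ev0 mulr0.
  by case: v E => // _; apply: dupil_nil.
rewrite (bigD1 (Ordinal vn)) //= eqxx /dupil E big1 ?addr0 // => -[i ilt].
by rewrite -val_eqE /= eqSS eq_sym => /negbTE ->; rewrite ev0 mulr0.
Qed.

Lemma sum_letters_dif w :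
  \sum_(x <- w) x = \sum_(j < size w) j.+1%:R * (dif w)`_j.
Proof.
have hd v : head 0 v = \sum_(j < size v) (dif v)`_j.
  elim: v => [|x v IH]; first by rewrite big_ord0.
  by rewrite big_ord_recl /= -IH subrK.
elim: w => [|x w IH]; first by rewrite big_nil big_ord0.
rewrite big_cons big_ord_recl /= mul1r IH.
under [in RHS]eq_bigr => j _ do rewrite /bump /= -addn1 natrD mulrDl mul1r.
by rewrite big_split /= -hd; ring.
Qed.

(** The factor [v_1] cancels the pole of [dipil] there; the sum of letters that remains is linear in
    [dif w]. *)
Lemma lam_dipil w : good w -> lam dipil w =
  ev (- ((size w).+1`!%:R^-1 *: \sum_(j < size w) j.+1%:R *: 'X^j)) w.
Proof.
move=> gw; rewrite -scaleNr evZ /lam dipilE /ev.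
have -> : evs (\sum_(j < size w) j.+1%:R *: 'X^j) (dif w) = \sum_(x <- w) x.
  have -> : \sum_(j < size w) j.+1%:R *: 'X^j = \poly_(j < size w) j.+1%:R :> {poly K}.
    by rewrite poly_def.
  rewrite sum_letters_dif /evs size_dif; apply: eq_bigr => j _.
  by rewrite coef_poly ltn_ord.
case: w gw => [|x w] gw; first by rewrite /= !mul0r big_nil !mulr0.
have x0 : x != 0 by move: gw; rewrite /good /= inE negb_or eq_sym => /andP[/andP[]].
by rewrite /=; field; rewrite x0 fact_neq0.
Qed.

Lemma delta_dupil w : good w -> delta dupil w = lam dipil w.
Proof.
move=> gw; case: w gw => [|x v] gw.
  by rewrite /delta theta_small ?dupil_nil // /der dupil_nil mul0rn subr0 /lam mul0r.
set w := x :: v in gw *.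
transitivity (\sum_(i < size w) bernoulli K i.+1 / i.+1`!%:R * delta (adI i) w).
  rewrite /delta (eq_theta _ (@dupil_adI (size w))) //.
  rewrite (@theta_sum _ _ _ (fun i => bernoulli K i.+1 / i.+1`!%:R) (@adI K)) //.
  rewrite /der (@dupil_adI (size w)) // -mulr_natl mulr_sumr -sumrB.
  by apply: eq_bigr => i _; rewrite -[adI i w *+ _]mulr_natl; ring.
rewrite lam_dipil // -(bernoulli_poly_sum charK) //.
rewrite (@ev_sum _ _ (fun i => (bernoulli K i.+1 / i.+1`!%:R) *:
     (((size w - i)`!%:R^-1 *: (('X - 1) ^+ i.-1 *+ i * ('X^(size w - i) - 1)))
      + ((size w).-1 - i)`!%:R^-1 *: (('X - 1) ^+ i * 'X^((size w).-1 - i))))).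
apply: eq_bigr => i _; rewrite evZ delta_adI // /fam /delta_adI_fam.
by rewrite ltn_ord.
Qed.

(** Agreement is asked only after deleting a nonempty factor: such words inherit [good], unlike
    arbitrary shorter ones. *)
Lemma eq_preari B A D w : B [::] = 0 ->
  (forall a b c, a ++ b ++ c = w -> b != [::] -> A (a ++ c) = D (a ++ c)) ->
  preari A B w = preari D B w.
Proof.
move=> B0 AD; rewrite !preariE //; congr (_ - _); apply: eq_csum => a v aw;
  apply: eq_csum => b c bv.
  by case: b bv => [|x b] bv; [rewrite B0 !mulr0 | rewrite (AD a (x :: b) c) ?bv].
by case: b bv => [|x b] bv; [rewrite B0 !mulr0 | rewrite (AD a (x :: b) c) ?bv].
Qed.

(** Both sides satisfy the same equation for [der], whose right side involves them only on shorter
    words; [der] is division-free up to the invertible length. *)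
Lemma lam_pil w : good w -> lam pil w = star dupil pil w.
Proof.
have [n] := ubnP (size w); elim: n w => // n IH w ltwn gw.
have [->|w0] := eqVneq w [::].
  by rewrite /lam mul0r /star /= addr0 dupil_nil mul0r.
have eF : preari (lam pil) dipil w = preari (star dupil pil) dipil w.
  apply: eq_preari => // a b c abc b0; apply: IH.
    rewrite -ltnS; apply: leq_trans ltwn; rewrite -abc !size_cat ltnS.
    by case: b b0 {abc} => //= y b _; lia.
  by apply: (@good_del _ a b); rewrite abc.
have e1 : der (lam pil) w = preari (lam pil) dipil w + star (lam dipil) pil w.
  by rewrite preari_lam // subrK /lam /der -mulrnAr -der_pil.
have e2 : der (star dupil pil) w =
    preari (star dupil pil) dipil w + star (lam dipil) pil w.
  rewrite der_star preari_star // -addrA; congr (_ + _).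
    by rewrite /star; apply: eq_csum => b c _; rewrite der_pil.
  rewrite -(@eq_star _ (delta dupil) (lam dipil) pil pil) //; last exact: delta_dupil.
  by rewrite -csumD; apply: eq_csum => b c _; rewrite /delta -mulrDl addrC subrK.
have : der (lam pil) w = der (star dupil pil) w by rewrite e1 e2 eF.
rewrite /der -mulr_natl -[RHS]mulr_natl; apply: mulfI.
by rewrite (pcharf0P K).1 // size_eq0.
Qed.

(** * Partial sums: from u-words to v-words *)

Fixpoint psums s : seq K :=
  if s is x :: t then (\sum_(y <- s) y) :: psums t else [::].

Lemma size_psums s : size (psums s) = size s.
Proof. by elim: s => //= x s ->. Qed.

Lemma head_psums s : head 0 (psums s) = \sum_(x <- s) x.
Proof. by case: s => //=; rewrite big_nil. Qed.

Lemma psums_rev u :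
  psums (rev u) = mkseq (fun i => \sum_(x <- take (size u - i) u) x) (size u).
Proof.
elim/last_ind: u => // u x IH; rewrite rev_rcons /= size_rcons IH /mkseq /=.
congr (_ :: _).
  rewrite subn0 take_oversize ?size_rcons // -rev_rcons.
  by apply: perm_big; rewrite perm_rev.
rewrite -[1%N]addn0 iotaDl -map_comp; apply/eq_in_map => i; rewrite mem_iota /= => iu.
by rewrite addnC addn1 subSS -cats1 takel_cat // leq_subr.
Qed.

Lemma swapE M u : swap M u = M (psums (rev u)).
Proof. by rewrite psums_rev. Qed.

Lemma off_poles_catl u v : off_poles (u ++ v) -> off_poles u.
Proof.
move=> huv i j /andP[ij ju]; have := huv i j.
by rewrite size_cat takel_cat //; apply; rewrite ij (leq_trans ju) // leq_addr.
Qed.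

Lemma dif_psums s : dif (psums s) = s.
Proof.
by elim: s => //= x s ->; rewrite head_psums big_cons addrK.
Qed.

(** Letters of the v-word and their differences are, up to sign, sums of consecutive letters of
    u. *)
Lemma good_psums u : off_poles u -> good (psums (rev u)).
Proof.
elim/last_ind: u => [|u x IH] hu //.
have sum_drop k : (k <= size u)%N -> \sum_(y <- drop k (rcons u x)) y != 0.
  by move=> ku; have := hu k (size u).+1; rewrite size_rcons take_oversize
    ?size_rcons // => -> //; rewrite ltnS ku leqnn.
have /IH: off_poles u by apply: (@off_poles_catl _ [:: x]); rewrite cats1.
rewrite /good rev_rcons /= inE negb_or => /andP[-> ->]; rewrite !andbT.
have -> : \sum_(y <- x :: rev u) y = \sum_(y <- rcons u x) y.
  by rewrite -rev_rcons; apply: perm_big; rewrite perm_rev.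
apply/andP; split; first by rewrite eq_sym -[rcons u x]drop0 sum_drop.
rewrite psums_rev; apply/mapP => -[i]; rewrite mem_iota /= => iu /eqP.
rewrite -{1}(cat_take_drop (size u - i) (rcons u x)) big_cat /= -cats1 takel_cat ?leq_subr //.
by rewrite -subr_eq0 addrAC subrr add0r cats1; apply/negP/sum_drop/leq_subr.
Qed.

Lemma psums_cat s t :
  psums (s ++ t) = [seq x + \sum_(y <- t) y | x <- psums s] ++ psums t.
Proof. by elim: s => //= x s ->; rewrite -[x :: s ++ t]cat_cons big_cat. Qed.

Lemma csum_psums (f : seq K -> seq K -> K) s : csum f (psums s) =
  csum (fun a b => f [seq x + \sum_(y <- b) y | x <- psums a] (psums b)) s.
Proof.
rewrite !csumE size_psums; apply: eq_bigr => -[i ir] _ /=.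
rewrite -{1 2}(cat_take_drop i s) psums_cat take_size_cat ?drop_size_cat //;
  by rewrite size_map size_psums size_takel.
Qed.

(** A cut shifts the left partial sums by the total of the right part, and the flexion removes
    exactly this shift. *)
Lemma star_psums A B s :
  star A B (psums s) = csum (fun a b => A (psums a) * B (psums b)) s.
Proof.
rewrite /star csum_psums; apply: eq_csum => a b _; congr (A _ * _).
rewrite /rflex -map_comp head_psums -[RHS]map_id; apply: eq_map => x /=.
exact: addrK.
Qed.

Lemma coef_Xsub1_exp n i : (i <= n)%N ->
  (('X - 1 : {poly K}) ^+ n)`_(n - i) = (-1) ^+ i * 'C(n, i)%:R.
Proof.
move=> lin; rewrite exprBn coef_sum (bigD1 (inord i)) //= inordK // big1 ?addr0.
  by rewrite expr1n mulr1 -signr_odd -(rmorph_sign polyC) coefMn coefCM coefXn eqxx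
    mulr1 signr_odd mulr_natr.
move=> [j jn]; rewrite -val_eqE /= inordK // => ji.
rewrite expr1n mulr1 -signr_odd -(rmorph_sign polyC) coefMn coefCM coefXn.
by rewrite (_ : (n - i == n - j)%N = false) ?mulr0 ?mul0rn //; lia.
Qed.

Lemma dupil_psums u : dupil (psums (rev u)) = dupal u.
Proof.
have -> : dupal u = bernoulli K (size u) / (size u)`!%:R * (\prod_(x <- u) x)^-1 *
    \sum_(i < size u) (-1) ^+ i * 'C((size u).-1, i)%:R * u`_i.
  by case: u => //; rewrite big_ord0 mulr0.
rewrite /dupil size_psums size_rev /ev /invdif dif_psums mulrA; congr (_ * _^-1 * _).
  by apply: perm_big; rewrite perm_rev.
rewrite /evs size_rev (reindex_inj rev_ord_inj) /=; apply: eq_bigr => -[i iw] _ /=.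
rewrite nth_rev; last by lia.
rewrite (_ : (size u - i.+1 = (size u).-1 - i)%N) ?coef_Xsub1_exp; try lia.
by congr (_ * _`_ _); lia.
Qed.

End Main.

Theorem theorem4p2p1 (K : fieldType) (charK : [pchar K] =i pred0)
  (u : seq K) (hu : off_poles u) : pal u = swap pil u.
Proof.
have [n] := ubnP (size u); elim: n u hu => // n IH u hu ltun.
have [->|u0] := eqVneq u [::]; first by [].
have gu := good_psums hu.
(* Reversing the word exchanges the factors, turning [star dupil pil] into the shape of
   [mu pal dupal]. *)
have := lam_pil charK gu; rewrite star_psums csum_rev.
have := dur_pal hu; rewrite /dur muE => e1 e2.
have s0 : \sum_(x <- u) x != 0.
  have := hu 0%N (size u); rewrite drop0 take_size leqnn andbT lt0n size_eq0; exact.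
apply: (mulfI s0); rewrite e1 swapE.
rewrite /lam head_psums in e2.
have <- : \sum_(x <- rev u) x = \sum_(x <- u) x.
  by apply: perm_big; rewrite perm_rev.
rewrite e2; apply: eq_csum => a b ab; rewrite dupil_psums mulrC.
(* The cut with a = u is killed by [dupal [::] = 0]; otherwise a is a proper prefix and induction
   applies. *)
case: b ab => [|y b] ab; first by rewrite /= !mul0r.
rewrite -swapE IH //; first by apply: (@off_poles_catl _ _ (y :: b)); rewrite ab.
by move: ltun; rewrite -ab size_cat /=; lia.
Qed.
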